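(* Let $\{\phi_j\}_{j\in\mathbb Z}$ be the Fourier basis $\phi_j(t)=e^{\mathrm ij\pi t}$ on $(-1,1)$ and let $T=\{t_n\}_{n=1}^N$ be a set of $N$ ordered points $t_1<\dots<t_N$ in $[-1,1]$. Then for every $r\in\mathbb N$ there exists $C_r>0$ such that $$\sigma_{\min}\ge1-\frac{C_rK^{-r}\xi^{-r-1/2}}{\sqrt{\xi/(2h)}-C_rK^{-r}\xi^{-r-1/2}},$$ where $\sigma_{\min}$ is the minimal singular value of $UP_K$. In particular, if $$K\ge\left(\sqrt2\,C_r(1+\epsilon^{-1})\right)^{1/r}h^{\frac1{2r}}\xi^{-1-\frac1r}$$ for some $0<\epsilon<1$, then $\sigma_{\min}>1-\epsilon$.
   Context: Fourier setting: $D=(-1,1)$, $\nu=1/2$, basis indexed by $\mathbb Z$. Voronoi cells $V_n=\{t\in(-1,1):|t-t_n|\le|t-t_m|\ \forall m\ne n\}$, quadrature weights $\tau_n=\int_{V_n}\nu$. $U$ is the $N\times\infty$ matrix $U_{n,j}=\sqrt{\tau_n}\phi_j(t_n)$, $j\in\mathbb Z$; $P_K$ is the coordinate projection onto indices $\{-K,\dots,K-1\}$; $\sigma_{\min}=\inf_{y\in\mathbb C^N,\|y\|=1}\|(UP_K)^*y\|$. $\xi=\frac12\min_{n=0,\dots,N}\{t_{n+1}-t_n\}$ with $t_0=-1$, $t_{N+1}=1$, and $h=\sup_{-1\le t\le1}\min_{n}|t-t_n|$.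
   Formalization: The first bound is stated only when ξ > 0 and the denominator √(ξ/(2h)) − C_r K^{-r} ξ^{-r-1/2} is positive (it fails otherwise, e.g. K=1 with many equispaced points, where σ_min=0); the second part assumes ξ > 0; r, K and N are at least 1. *)

(* Defs.v *)
From mathcomp Require Import all_boot all_order all_algebra.
From mathcomp Require Import all_classical all_reals all_analysis.
From mathcomp Require Import complex.
Set Implicit Arguments. Unset Strict Implicit. Unset Printing Implicit Defensive.
Import Order.TTheory GRing.Theory Num.Theory.
Local Open Scope classical_set_scope.
Local Open Scope ring_scope.
Local Open Scope complex_scope.

Section FourierSampling.
Variable R : realType.

Definition cmod2 (z : R[i]) : R := (complex.Re z) ^+ 2 + (complex.Im z) ^+ 2.

Definition phi (j : int) (s : R) : R[i] :=
  (cos (j%:~R * pi * s)) +i* (sin (j%:~R * pi * s)).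

(* sample points t_1, ..., t_N (indices 1..N of t : nat -> R) *)
Variables (N : nat) (t : nat -> R).

Definition text (n : nat) : R :=
  if n == 0%N then -1 else if n == N.+1 then 1 else t n.

Definition xi : R :=
  2^-1 * inf [set text n.+1 - text n | n in [set n : nat | (n <= N)%N]].

Definition hfill : R :=
  sup [set inf [set `|s - t n| | n in [set n : nat | (1 <= n <= N)%N]]
      | s in [set s : R | -1 <= s <= 1]].

Definition voronoi (n : nat) : set R :=
  [set s : R | -1 < s < 1 /\
     forall m : nat, (1 <= m <= N)%N -> m <> n -> `|s - t n| <= `|s - t m|].

(* quadrature weights tau_n = int_{V_n} nu,  nu = 1/2 (density wrt Lebesgue) *)
Definition tau (n : nat) : R := 2^-1 * fine (lebesgue_measure (voronoi n)).

Definition Umat (n : nat) (j : int) : R[i] := (Num.sqrt (tau n))%:C * phi j (t n).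

(* || (U P_K)^* y ||^2 = sum_{j=-K}^{K-1} | sum_n conj(U_{n,j}) y_n |^2 *)
Definition adj_norm2 (K : nat) (y : nat -> R[i]) : R :=
  \sum_(0 <= k < K.*2)
     cmod2 (\sum_(1 <= n < N.+1) (Umat n (k%:Z - K%:Z))^* * y n).

Definition sigma_min (K : nat) : R :=
  inf [set Num.sqrt (adj_norm2 K y)
      | y in [set y : nat -> R[i] | \sum_(1 <= n < N.+1) cmod2 (y n) = 1]].

End FourierSampling.

(* Main.v *)
Require Import Defs.
From mathcomp Require Import all_boot all_order all_algebra.
From mathcomp Require Import all_classical all_reals all_analysis.
From mathcomp Require Import complex ring lra zify.
Import Order.TTheory GRing.Theory Num.Theory numFieldNormedType.Exports.
Local Open Scope ring_scope.

(* The nodes are 2 xi-separated modulo 2, so a large-sieve argument bounds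
   sigma_min from below.  Averaging |sum_n c_n e^(-i j pi t_n)|^2 over the
   frequencies j = p - q with 0 <= p, q < K (Fejer weights) gives the quadratic
   form with matrix |D_K(t_n - t_m)|^2, D_K the Dirichlet kernel.  Its diagonal
   is K^2, while by |D_K(s)|^2 <= 2 / dist(s, 2Z)^2 and the separation
   its off-diagonal row sums are at most 4 / xi^2.  Since tau_n >= xi this
   yields sigma_min^2 >= K xi - 4 / (K xi), which is at least 1 as soon as
   K xi >= 3.  With C = 3^r both hypotheses of the theorem force K xi >= 3
   (using xi <= 1/2 and 2 xi <= h), so sigma_min >= 1 in both cases. *)

(** * Sums of inverse squares *)

Lemma ler_sum_uniq_sub {R : realType} (I : eqType) (s s' : seq I) (F : I -> R) :
  uniq s -> uniq s' -> {subset s <= s'} -> (forall i, 0 <= F i) ->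
  \sum_(i <- s) F i <= \sum_(i <- s') F i.
Proof.
move=> us us' ss' F0.
have -> : \sum_(i <- s) F i = \sum_(i <- s' | i \in s) F i.
  rewrite -[RHS]big_filter; apply: perm_big; apply: uniq_perm => //.
    exact: filter_uniq.
  by move=> i; rewrite mem_filter; case: (boolP (i \in s)) => //= /ss'.
rewrite [leRHS](bigID (mem s)) /=.
by rewrite lerDl sumr_ge0.
Qed.

(** Telescoping: $1/(a+1)^2\le 1/a-1/(a+1)$. *)
Lemma sum_inv_sqr_le {R : realType} (n : nat) :
  \sum_(1 <= k < n.+2) (k%:R : R) ^- 2 <= 2 - (n.+1%:R)^-1.
Proof.
elim: n => [|n IH]; first by rewrite big_nat1; lra.
rewrite big_nat_recr //=.
have [a0 b0] : 0 < (n.+1%:R : R) /\ 0 < (n.+2%:R : R) by [].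
have ab : (n.+2%:R : R) = n.+1%:R + 1 by rewrite -natr1.
move: IH; rewrite ab in b0 *; move: (n.+1%:R : R) a0 b0 => a a0 b0 IH.
have : (a + 1) ^- 2 <= a^-1 - (a + 1)^-1.
  have -> : a^-1 - (a + 1)^-1 = (a * (a + 1))^-1 by field; rewrite !gt_eqF.
  by rewrite lef_pV2 ?posrE ?exprn_gt0 ?mulr_gt0 // expr2 ler_pM2r // lerDl.
lra.
Qed.

Lemma sum_inv_sqr_uniq {R : realType} (s : seq nat) :
  uniq s -> 0%N \notin s -> \sum_(k <- s) (k%:R : R) ^- 2 <= 2.
Proof.
move=> us s0; pose M := \max_(k <- s) k.
apply: le_trans (_ : \sum_(1 <= k < M.+2) (k%:R : R) ^- 2 <= _).
  apply: ler_sum_uniq_sub => //; first exact: iota_uniq.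
  move=> k ks; rewrite mem_index_iota; apply/andP; split.
    by rewrite lt0n; apply: contraNneq s0 => <-.
  by rewrite ltnS leqW //; exact: (@leq_bigmax_seq _ s xpredT id).
by apply: le_trans (@sum_inv_sqr_le R M) _; rewrite lerBlDr lerDl.
Qed.

(** * Estimates for the Dirichlet kernel *)

Lemma sin_ge_mulcos {R : realType} (x : R) :
  0 <= x <= pi / 2 -> x * cos x <= sin x.
Proof.
move=> /andP[]; rewrite le_eqVlt => /predU1P[<- _|x0 xpi].
  by rewrite mul0r sin0.
have [|c] := @MVT R sin cos 0 x x0 (fun c _ => is_derive_sin c).
  exact/continuous_subspaceT/continuous_sin.
rewrite in_itv /= => /andP[c0 cx]; rewrite sin0 !subr0 => ->.
rewrite mulrC ler_pM2r // ltW // ltr_cos // in_itv /=; have := pi_ge0 R; lra.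
Qed.

(** For $s>1/2$ the cosine is nonpositive and $s^2\le1$. For $s\le1/2$ put $x=\pi s/2\ge s$: then
    $1-\cos2x=2\sin^2x\ge2x^2\cos^2x\ge x^2$, since $\cos2x\ge0$ means $\cos^2x\ge1/2$. *)
Lemma sqr_le_1Bcos {R : realType} (s : R) :
  0 <= s <= 1 -> s ^+ 2 <= 1 - cos (pi * s).
Proof.
move=> /andP[s0 s1]; have p2 := pi_ge2 R.
have [sh|sh] := leP s 2^-1; last first.
  have : cos (pi * s) <= 0.
    rewrite -cos_pihalf le_eqVlt ltr_cos ?orbT // ?in_itv /=; nra.
  nra.
set x := pi * s / 2.
have -> : pi * s = x *+ 2 by rewrite /x mulr2n; lra.
have x0 : 0 <= x by rewrite /x; nra.
have x4 : x *+ 2 <= pi / 2 by rewrite /x mulr2n; nra.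
have c2 : 0 <= cos (x *+ 2).
  by apply: cos_ge0_pihalf; move: x4; rewrite mulr2n; lra.
have sx : x * cos x <= sin x by apply: sin_ge_mulcos; move: x4; rewrite mulr2n; lra.
have c1 : 0 <= cos x by apply: cos_ge0_pihalf; move: x4; rewrite mulr2n; lra.
have := cos2Dsin2 x; move: c2; rewrite cos_mulr2n.
have sx2 : s <= x by rewrite /x; nra.
have h : (x * cos x) ^+ 2 <= (sin x) ^+ 2 by rewrite ler_sqr // nnegrE; nra.
move: h; rewrite exprMn.
have h2 : s ^+ 2 <= x ^+ 2 by rewrite ler_sqr // nnegrE.
move: (x ^+ 2) h2 (sqr_ge0 s) => X h2 s20; rewrite mulr2n => h c2 e. nra.
Qed.

(** This is $|D_K(x)|^2$ for the one-sided kernel $D_K(x)=\sum_{a<K}e^{iax}$, written with real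
    quantities only. *)
Definition dirichlet2 {R : realType} (K : nat) (x : R) : R :=
  (\sum_(0 <= a < K) cos (a%:R * x)) ^+ 2 + (\sum_(0 <= a < K) sin (a%:R * x)) ^+ 2.

(** The geometric sum satisfies $D_K(x)(1-e^{ix})=1-e^{iKx}$; [h1] and [h2] are its real and
    imaginary parts. Squared moduli give $|D_K(x)|^2(1-\cos x)=1-\cos Kx$. *)
Lemma dirichlet2_le {R : realType} (K : nat) (x : R) :
  dirichlet2 K x * (1 - cos x) <= 2.
Proof.
rewrite /dirichlet2; set C := \sum_(_ <= _ < _) cos _; set S := \sum_(_ <= _ < _) _.
have [h1 h2] : C * (1 - cos x) + S * sin x = 1 - cos (K%:R * x) /\
  S * (1 - cos x) - C * sin x = - sin (K%:R * x).
  rewrite {}/C {}/S; elim: K => [|K [IH1 IH2]].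
    by rewrite !big_geq // !mul0r cos0 sin0; split; lra.
  rewrite !big_nat_recr //= -natr1 !mulrDl !mul1r cosD sinD.
  by split; lra.
have := cos2Dsin2 x; have := cos2Dsin2 (K%:R * x); have := cos_geN1 (K%:R * x).
move: h1 h2; move: (cos (K%:R * x)) (sin (K%:R * x)) (cos x) (sin x).
move=> ck sk c s h1 h2 h3 h4 h5.
have e : (C ^+ 2 + S ^+ 2) * ((1 - c) ^+ 2 + s ^+ 2) = (1 - ck) ^+ 2 + sk ^+ 2.
  by rewrite -h1 -[sk]opprK -h2; ring.
have -> : (C ^+ 2 + S ^+ 2) * (1 - c) = ((1 - ck) ^+ 2 + sk ^+ 2) / 2.
  rewrite -e; have -> : s ^+ 2 = 1 - c ^+ 2 by lra.
  by field.
have -> : sk ^+ 2 = 1 - ck ^+ 2 by lra.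
nra.
Qed.

Lemma dirichlet2N {R : realType} (K : nat) (x : R) :
  dirichlet2 K (- x) = dirichlet2 K x.
Proof.
rewrite /dirichlet2; congr (_ ^+ 2 + _).
  by apply: eq_bigr => a _; rewrite mulrN cosN.
rewrite -sqrrN -sumrN; congr (_ ^+ 2).
by apply: eq_bigr => a _; rewrite mulrN sinN opprK.
Qed.

Lemma dirichlet2_at0 {R : realType} (K : nat) : dirichlet2 K (0 : R) = K%:R ^+ 2.
Proof.
rewrite /dirichlet2 (eq_bigr (fun=> 1)); last by move=> a _; rewrite mulr0 cos0.
rewrite [X in _ + X ^+ 2]big1; last by move=> a _; rewrite mulr0 sin0.
by rewrite expr0n addr0 sumr_const_nat subn0.
Qed.

(* Either s or 2 - s is at most 1; adding both contributions avoids the minimum. *)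
Lemma dirichlet2_bound {R : realType} (K : nat) (s p q : R) :
  0 < p -> 0 < q -> p <= s -> q <= 2 - s ->
  dirichlet2 K (pi * s) <= 2 * (p ^- 2 + q ^- 2).
Proof.
move=> p0 q0 ps qs.
have D0 (x : R) : 0 <= dirichlet2 K x by rewrite addr_ge0 ?sqr_ge0.
have key (u v : R) : 0 < v -> v <= u -> u <= 1 ->
    cos (pi * u) = cos (pi * s) -> dirichlet2 K (pi * s) <= 2 * v ^- 2.
  move=> v0 vu u1 e.
  have := dirichlet2_le K (pi * s); rewrite -e.
  have := @sqr_le_1Bcos R u; rewrite u1 (le_trans (ltW v0) vu) => /(_ isT).
  have : v ^+ 2 <= u ^+ 2 by rewrite ler_sqr // nnegrE; lra.
  rewrite ler_pdivlMr ?exprn_gt0 //; have := D0 (pi * s).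
  by move=> ? ? ? ?; nra.
have [ip iq] : 0 <= p ^- 2 /\ 0 <= q ^- 2 by rewrite !invr_ge0 !sqr_ge0.
have [s1|s1] := leP s 1.
  by apply: le_trans (key s p _ _ _ _) _ => //; lra.
apply: le_trans (key (2 - s) q _ _ _ _) _ => //; try lra.
rewrite mulrBr; have -> : pi * 2 - pi * s = - (pi * s) + pi *+ 2.
  by rewrite mulr2n; lra.
by rewrite cosD2pi cosN.
Qed.

(** * Off-diagonal row sums of the kernel matrix *)

Lemma sum_inv_sqr_inj {R : realType} (s : seq nat) (P : pred nat) (f : nat -> nat) :
  uniq s -> {in [seq i <- s | P i] &, injective f} ->
  (forall i, i \in s -> P i -> (0 < f i)%N) ->
  \sum_(i <- s | P i) ((f i)%:R : R) ^- 2 <= 2.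
Proof.
move=> us finj f0.
rewrite -big_filter -(big_map f xpredT (fun k => (k%:R : R) ^- 2)).
apply: sum_inv_sqr_uniq.
  by rewrite map_inj_in_uniq // filter_uniq.
apply/mapP => -[j]; rewrite mem_filter => /andP[Pj sj] e.
by have := f0 j sj Pj; rewrite -e.
Qed.

(** On the circle $\mathbb R/2\mathbb Z$ the node $m$ lies $|n-m|$ gaps from $n$ one way and
    $N+1-|n-m|$ the other way. Two directions and two sides of $n$ give four sums of inverse
    squares, each at most 2, with the factor $2/d^2$. *)
Lemma dirichlet2_sum_le {R : realType} (N K n : nat) (t : nat -> R) (d : R) :
  0 < d -> (1 <= n <= N)%N ->
  (forall i j, (1 <= i)%N -> (i < j)%N -> (j <= N)%N ->
     d * (j - i)%:R <= t j - t i /\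
     d * (N.+1 - (j - i))%:R <= 2 - (t j - t i)) ->
  \sum_(1 <= m < N.+1 | m != n) dirichlet2 K (pi * (t n - t m)) <= 16 / d ^+ 2.
Proof.
move=> d0 /andP[n1 nN] sep.
(* This is $|n-m|$: subtraction is truncated, so at least one summand is zero. *)
pose k m := ((n - m) + (m - n))%N.
apply: (@le_trans _ _ (\sum_(1 <= m < N.+1 | m != n)
    (2 / d ^+ 2 * ((k m)%:R ^- 2 + (N.+1 - k m)%:R ^- 2)))).
  rewrite big_nat_cond [leRHS]big_nat_cond.
  apply: ler_sum => m /andP[/andP[m1 mN] mn].
  have -> : 2 / d ^+ 2 * ((k m)%:R ^- 2 + (N.+1 - k m)%:R ^- 2)
     = 2 * ((d * (k m)%:R) ^- 2 + (d * (N.+1 - k m)%:R) ^- 2) :> R.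
    by rewrite !exprMn !invfM; ring.
  have D0 i : (0 < i)%N -> 0 < d * i%:R by move=> i0; rewrite mulr_gt0 // ltr0n.
  have [mltn|nltm|e] := ltngtP m n; last by rewrite e eqxx in mn.
  - have -> : k m = (n - m)%N by rewrite /k; lia.
    have [h1 h2] := sep m n m1 mltn nN.
    by apply: dirichlet2_bound => //; apply: D0; lia.
  - have -> : k m = (m - n)%N by rewrite /k; lia.
    have [h1 h2] := sep n m n1 nltm mN.
    rewrite -dirichlet2N -mulrN opprB.
    by apply: dirichlet2_bound => //; apply: D0; lia.
rewrite -big_distrr /= big_split /=.
have bnd (f : nat -> nat) :
    {in [pred m | 1 <= m < n]%N &, injective f} ->
    {in [pred m | n < m <= N]%N &, injective f} ->
    (forall m, (1 <= m <= N)%N -> m != n -> (0 < f m)%N) ->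
    \sum_(1 <= m < N.+1 | m != n) ((f m)%:R : R) ^- 2 <= 4.
  (* Each distance occurs at most once on either side of $n$, but possibly on both, so injectivity
     holds only after this split. *)
  move=> fl fr f0; rewrite (bigID (fun m => (m < n)%N)) /=.
  have -> : 4 = 2 + 2 :> R by lra.
  apply: lerD; apply: sum_inv_sqr_inj; rewrite ?iota_uniq //.
  - by move=> i j; rewrite !mem_filter !mem_index_iota => hi hj; apply: fl; rewrite inE; lia.
  - by move=> i; rewrite mem_index_iota => hi hj; apply: f0; lia.
  - by move=> i j; rewrite !mem_filter !mem_index_iota => hi hj; apply: fr; rewrite inE; lia.
  - by move=> i; rewrite mem_index_iota => hi hj; apply: f0; lia.
have b1 := bnd k; have b2 := bnd (fun m => (N.+1 - k m)%N).
have -> : 16 / d ^+ 2 = 2 / d ^+ 2 * (4 + 4) by ring.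
rewrite ler_pM2l ?divr_gt0 ?exprn_gt0 //; apply: lerD.
  by apply: b1 => [i j|i j|i]; rewrite ?inE /k; lia.
by apply: b2 => [i j|i j|i]; rewrite ?inE /k; lia.
Qed.

(** * The Fejer-averaged quadratic form and its lower bound *)

Lemma exchange_big3 {R : nmodType} (I J L : Type) (r : seq I) (s : seq J)
    (u : seq L) (F : I -> J -> L -> R) :
  \sum_(i <- r) \sum_(j <- s) \sum_(l <- u) F i j l =
  \sum_(l <- u) \sum_(i <- r) \sum_(j <- s) F i j l.
Proof.
by rewrite [RHS]exchange_big /=; apply: eq_bigr => i _; rewrite exchange_big.
Qed.

Lemma sum_cosB {R : realType} (K : nat) (x : R) :
  \sum_(0 <= p < K) \sum_(0 <= q < K) cos ((p%:R - q%:R) * x) = dirichlet2 K x.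
Proof.
rewrite /dirichlet2 !expr2 !big_distrlr /= -big_split /=; apply: eq_bigr => p _.
by rewrite -big_split /=; apply: eq_bigr => q _; rewrite mulrBl cosB.
Qed.

Lemma sum_sinB {R : realType} (K : nat) (x : R) :
  \sum_(0 <= p < K) \sum_(0 <= q < K) sin ((p%:R - q%:R) * x) = 0.
Proof.
set S := LHS; suff : S = - S by lra.
rewrite {1}/S exchange_big -sumrN; apply: eq_bigr => p _.
by rewrite -sumrN; apply: eq_bigr => q _; rewrite -sinN -mulNr opprB.
Qed.

(* The squared modulus of the sum over n of (a_n + i b_n) e^(-i z x_n). *)
Definition expsum2 {R : realType} (s : seq nat) (a b x : nat -> R) (z : R) : R :=
  (\sum_(n <- s) (a n * cos (z * x n) + b n * sin (z * x n))) ^+ 2 +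
  (\sum_(n <- s) (b n * cos (z * x n) - a n * sin (z * x n))) ^+ 2.

Lemma sum_expsum2 {R : realType} (s : seq nat) (a b x : nat -> R) (K : nat) :
  \sum_(0 <= p < K) \sum_(0 <= q < K) expsum2 s a b x (p%:R - q%:R) =
  \sum_(n <- s) \sum_(m <- s) (a n * a m + b n * b m) * dirichlet2 K (x n - x m).
Proof.
(* The real part of $c_n\overline{c_m}e^{-iz(x_n-x_m)}$ with $c=a+ib$ and $z=p-q$. Summed over
   $p,q$, its sine part vanishes by antisymmetry and its cosine part gives $|D_K|^2$. *)
pose F p q n m : R :=
  (a n * a m + b n * b m) * cos ((p%:R - q%:R) * (x n - x m)) +
  (b n * a m - a n * b m) * sin ((p%:R - q%:R) * (x n - x m)).
transitivity (\sum_(0 <= p < K) \sum_(0 <= q < K)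
    \sum_(n <- s) \sum_(m <- s) F p q n m).
  apply: eq_bigr => p _; apply: eq_bigr => q _.
  rewrite /expsum2 !expr2 !big_distrlr /= -big_split /=; apply: eq_bigr => n _.
  rewrite -big_split /=; apply: eq_bigr => m _.
  by rewrite /F [_ * (x n - x m)]mulrBr cosB sinB /=; ring.
rewrite exchange_big3; apply: eq_bigr => n _.
rewrite exchange_big3; apply: eq_bigr => m _.
transitivity ((a n * a m + b n * b m) * dirichlet2 K (x n - x m) +
  (b n * a m - a n * b m) * 0); last by rewrite mulr0 addr0.
rewrite -[X in _ + _ * X](sum_sinB K (x n - x m)) -sum_cosB !big_distrr -big_split /=.
by apply: eq_bigr => p _; rewrite !big_distrr -big_split.
Qed.

(** Schur test: each off-diagonal term is at least $-\frac12(|c_n|^2+|c_m|^2)D_{nm}$, and by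
    symmetry of [D] both halves add up to the same weighted row sums [E]. *)
Lemma schur_lower_bound {R : realType} (s : seq nat) (a b : nat -> R)
    (D : nat -> nat -> R) (A B : R) :
  uniq s -> (forall n m, 0 <= D n m) -> (forall n m, D n m = D m n) ->
  (forall n, D n n = A) ->
  (forall n, n \in s -> \sum_(m <- s | m != n) D n m <= B) ->
  (A - B) * \sum_(n <- s) (a n ^+ 2 + b n ^+ 2) <=
  \sum_(n <- s) \sum_(m <- s) (a n * a m + b n * b m) * D n m.
Proof.
move=> us D0 Dsym Dn DB; pose w n := a n ^+ 2 + b n ^+ 2.
have w0 n : 0 <= w n by rewrite addr_ge0 ?sqr_ge0.
pose E := \sum_(n <- s) w n * \sum_(m <- s | m != n) D n m.
have EB : E <= B * \sum_(n <- s) w n.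
  rewrite big_distrr /= /E big_seq [leRHS]big_seq; apply: ler_sum => n ns.
  by rewrite [leRHS]mulrC ler_wpM2l // DB.
have E' : \sum_(n <- s) \sum_(m <- s | m != n) w m * D n m = E.
  rewrite (exchange_big_dep xpredT) //=; apply: eq_bigr => n _.
  rewrite big_distrr; apply: eq_big => [m|m _]; first by rewrite eq_sym.
  by rewrite Dsym.
apply: (@le_trans _ _ (\sum_(n <- s)
   (w n * A - \sum_(m <- s | m != n) (2^-1 * (w n * D n m) + 2^-1 * (w m * D n m))))).
  rewrite [leRHS]big_split /= sumrN -big_distrl /=.
  under [X in _ <= _ - X]eq_bigr do rewrite big_split /= -!big_distrr /=.
  rewrite [X in _ <= _ - X]big_split /= -!big_distrr /= E' -/E; move: EB; rewrite -/w.
  by move: (\sum_(n <- s) w n) => W; rewrite mulrBl (mulrC W); lra.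
rewrite big_seq [leRHS]big_seq; apply: ler_sum => n ns.
rewrite [leRHS](bigD1_seq n) //= Dn; apply: lerD; first by rewrite /w !expr2.
rewrite -sumrN; apply: ler_sum => m _.
have -> : - (2^-1 * (w n * D n m) + 2^-1 * (w m * D n m)) =
  - (2^-1 * (w n + w m)) * D n m by ring.
rewrite ler_wpM2r // /w.
by have := sqr_ge0 (a n + a m); have := sqr_ge0 (b n + b m); rewrite !expr2; lra.
Qed.

(** For $q<K$ the frequencies $p-q$ are distinct and lie in the window $\{-K,\dots,K-1\}$; the
    remaining terms are nonnegative. *)
Lemma sum_shift_le {R : realType} (K q : nat) (H : R -> R) :
  (forall z, 0 <= H z) -> (q < K)%N ->
  \sum_(0 <= p < K) H (p%:R - q%:R) <= \sum_(0 <= k < K.*2) H (k%:R - K%:R).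
Proof.
move=> H0 qK; pose f p := (p + (K - q))%N.
rewrite (eq_bigr (fun p => H ((f p)%:R - K%:R))); last first.
  by move=> p _; rewrite /f natrD natrB 1?ltnW //; congr H; ring.
rewrite -(big_map f xpredT (fun k => H (k%:R - K%:R))).
apply: ler_sum_uniq_sub => //; rewrite ?iota_uniq //.
  by rewrite map_inj_uniq ?iota_uniq // => i j; rewrite /f; lia.
move=> k /mapP [p]; rewrite !mem_index_iota => pK ->; rewrite /f; lia.
Qed.

Lemma separated_lower_bound {R : realType} (N K : nat) (t a b : nat -> R) (d : R) :
  0 < d -> (0 < K)%N ->
  (forall i j, (1 <= i)%N -> (i < j)%N -> (j <= N)%N ->
     d * (j - i)%:R <= t j - t i /\
     d * (N.+1 - (j - i))%:R <= 2 - (t j - t i)) ->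
  (K%:R - 16 / (K%:R * d ^+ 2)) * \sum_(1 <= n < N.+1) (a n ^+ 2 + b n ^+ 2) <=
  \sum_(0 <= k < K.*2)
     expsum2 (index_iota 1 N.+1) a b (fun n => pi * t n) (k%:R - K%:R).
Proof.
move=> d0 K0 sep; set s := index_iota 1 N.+1; set x := fun n => pi * t n.
have k0 : 0 < K%:R :> R by rewrite ltr0n.
rewrite -(ler_pM2l k0).
(* Fejer averaging: frequencies p - q with p, q < K, each hit at most K times. *)
apply: (@le_trans _ _ (\sum_(0 <= p < K) \sum_(0 <= q < K)
    expsum2 s a b x (p%:R - q%:R))).
  rewrite sum_expsum2 mulrA.
  have -> : K%:R * (K%:R - 16 / (K%:R * d ^+ 2)) = K%:R ^+ 2 - 16 / d ^+ 2 :> R.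
    by field; rewrite !gt_eqF.
  apply: (@schur_lower_bound _ _ _ _ (fun n m => dirichlet2 K (x n - x m))).
  - exact: iota_uniq.
  - by move=> n m; rewrite addr_ge0 ?sqr_ge0.
  - by move=> n m; rewrite -dirichlet2N opprB.
  - by move=> n; rewrite subrr dirichlet2_at0.
  - move=> n; rewrite mem_index_iota => nN.
    under eq_bigr do rewrite -mulrBr.
    exact: dirichlet2_sum_le.
have cst (A : R) : K%:R * A = \sum_(0 <= q < K) A.
  by rewrite sumr_const_nat subn0 mulr_natl.
rewrite [leRHS]cst exchange_big /= big_nat [leRHS]big_nat.
apply: ler_sum => q qK; apply: sum_shift_le => // z.
by rewrite addr_ge0 ?sqr_ge0.
Qed.

(** * Geometry of the nodes and the Voronoi weights *)

Lemma text_in {R : realType} (N n : nat) (t : nat -> R) :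
  (1 <= n <= N)%N -> text N t n = t n.
Proof. by rewrite /text => nN; rewrite !ifF //; apply/eqP; lia. Qed.

Lemma text_gap {R : realType} (N : nat) (t : nat -> R) (n : nat) :
  (0 < N)%N -> (forall n : nat, (1 <= n < N)%N -> t n < t n.+1) ->
  -1 <= t 1%N -> t N <= 1 -> (n <= N)%N ->
  2 * xi N t <= text N t n.+1 - text N t n.
Proof.
move=> N0 tinc t1 tN nN.
rewrite /xi mulrA divff ?pnatr_eq0 // mul1r; apply: ge_inf; last by exists n.
(* Nonnegative gaps bound the set below, as [ge_inf] requires. *)
exists 0 => _ [m /= mN <-]; rewrite subr_ge0.
have [->|m0] := eqVneq m 0%N.
  by rewrite [text _ _ 1%N]text_in.
have [->|mneN] := eqVneq m N.
  by rewrite (@text_in _ N N) ?N0 ?leqnn // /text eqxx.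
by rewrite !text_in ?ltW ?tinc //; lia.
Qed.

Lemma text_separation {R : realType} (N : nat) (t : nat -> R) (i j : nat) :
  (0 < N)%N -> (forall n : nat, (1 <= n < N)%N -> t n < t n.+1) ->
  -1 <= t 1%N -> t N <= 1 -> (i <= j <= N.+1)%N ->
  2 * xi N t * (j - i)%:R <= text N t j - text N t i.
Proof.
move=> N0 tinc t1 tN /andP[ij jN].
rewrite -(subnK ij) addnK; move: (j - i)%N (subnK ij) => k e.
have : (k + i <= N.+1)%N by rewrite e.
elim: k {e} => [|k IH] h; first by rewrite mulr0 subrr.
have {}IH := IH (ltnW h).
have := @text_gap R N t (k + i)%N N0 tinc t1 tN h.
rewrite -[k.+1%:R]natr1 mulrDr mulr1 addSn; lra.
Qed.

(** The second bound is separation modulo 2: going round through $1=-1$ crosses $N+1-j$ gaps right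
    of $t_j$ and $i$ gaps left of $t_i$. *)
Lemma sample_separation {R : realType} (N : nat) (t : nat -> R) (i j : nat) :
  (0 < N)%N -> (forall n : nat, (1 <= n < N)%N -> t n < t n.+1) ->
  -1 <= t 1%N -> t N <= 1 -> (1 <= i)%N -> (i < j)%N -> (j <= N)%N ->
  2 * xi N t * (j - i)%:R <= t j - t i /\
  2 * xi N t * (N.+1 - (j - i))%:R <= 2 - (t j - t i).
Proof.
move=> N0 tinc t1 tN i1 ij jN.
have S := @text_separation R N t _ _ N0 tinc t1 tN.
have ti : text N t i = t i by rewrite text_in //; lia.
have tj : text N t j = t j by rewrite text_in //; lia.
have tN1 : text N t N.+1 = 1 by rewrite /text eqxx.
split; first by rewrite -ti -tj; apply: S; lia.
have Sl := S 0%N i ltac:(lia); have Sr := S j N.+1 ltac:(lia).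
have -> : (N.+1 - (j - i) = (N.+1 - j) + (i - 0))%N by lia.
rewrite natrD mulrDr; move: Sl Sr; rewrite ti tj tN1 /text /=; lra.
Qed.

Lemma sample_boundary_gap {R : realType} (N : nat) (t : nat -> R) (n : nat) :
  (0 < N)%N -> (forall n : nat, (1 <= n < N)%N -> t n < t n.+1) ->
  -1 <= t 1%N -> t N <= 1 -> 0 < xi N t -> (1 <= n <= N)%N ->
  2 * xi N t <= t n + 1 /\ 2 * xi N t <= 1 - t n.
Proof.
move=> N0 tinc t1 tN xi0 nN.
have S := @text_separation R N t _ _ N0 tinc t1 tN.
have tn : text N t n = t n by rewrite text_in.
have tN1 : text N t N.+1 = 1 by rewrite /text eqxx.
have t0 : text N t 0 = -1 by [].
have x2 : 0 < 2 * xi N t by rewrite mulr_gt0.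
have Sl := S 0%N n ltac:(lia); have Sr := S n N.+1 ltac:(lia).
rewrite tn t0 opprK in Sl; rewrite tn tN1 in Sr.
split; [apply: le_trans Sl|apply: le_trans Sr];
  by rewrite -[leLHS]mulr1 ler_pM2l // ler1n; lia.
Qed.

Lemma xi_le_half {R : realType} (N : nat) (t : nat -> R) :
  (0 < N)%N -> (forall n : nat, (1 <= n < N)%N -> t n < t n.+1) ->
  -1 <= t 1%N -> t N <= 1 -> 0 < xi N t -> xi N t <= 2^-1.
Proof.
move=> N0 tinc t1 tN xi0.
by have [] := @sample_boundary_gap R N t 1 N0 tinc t1 tN xi0 N0; lra.
Qed.

(** After squaring, each condition $|s-t_n|\le|s-t_m|$ is affine in $s$. This yields measurability
    of the cell. *)
Lemma voronoi_is_interval {R : realType} (N : nat) (t : nat -> R) (n : nat) :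
  is_interval (voronoi N t n).
Proof.
move=> x y [/andP[x1 x2] hx] [/andP[y1 y2] hy] z /andP[xz zy].
split; first by apply/andP; split; lra.
move=> m mN mn; have := hx m mN mn; have := hy m mN mn.
rewrite -!(@ler_sqr _ `|_ - t n|) ?nnegrE // !real_normK ?num_real // !sqrrB.
by case: (leP (t n) (t m)) => ?; nra.
Qed.

(** The cell contains the open interval of radius $\xi$ around $t_n$, of measure $2\xi$, and
    $\nu=1/2$. *)
Lemma xi_le_tau {R : realType} (N : nat) (t : nat -> R) (n : nat) :
  (0 < N)%N -> (forall n : nat, (1 <= n < N)%N -> t n < t n.+1) ->
  -1 <= t 1%N -> t N <= 1 -> 0 < xi N t -> (1 <= n <= N)%N ->
  xi N t <= tau N t n.
Proof.
move=> N0 tinc t1 tN xi0 nN.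
have [gl gr] := @sample_boundary_gap R N t n N0 tinc t1 tN xi0 nN.
set x := xi N t in xi0 gl gr *.
have sub1 : (`](t n - x)%R, (t n + x)%R[ `<=` voronoi N t n)%classic.
  move=> s /=; rewrite in_itv /= => /andP[s1 s2].
  split; first by apply/andP; split; lra.
  move=> m mN mn.
  have sn : `|s - t n| <= x by rewrite ler_norml; lra.
  apply: le_trans sn _; rewrite ler_normr.
  have x2 : 0 < 2 * x by rewrite mulr_gt0.
  have grow (k : nat) : (0 < k)%N -> 2 * x <= 2 * x * k%:R.
    by move=> k0; rewrite -[leLHS]mulr1 ler_pM2l // ler1n.
  have [mltn|nltm|e] := ltngtP m n; last by [].
  - have [+ _] := @sample_separation R N t m n N0 tinc t1 tN ltac:(lia) mltn ltac:(lia).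
    by have := grow (n - m)%N ltac:(lia); rewrite -/x; lra.
  - have [+ _] := @sample_separation R N t n m N0 tinc t1 tN ltac:(lia) nltm ltac:(lia).
    by have := grow (m - n)%N ltac:(lia); rewrite -/x; lra.
have sub2 : (voronoi N t n `<=` `](-1)%R, 1%R[)%classic.
  by move=> s [? _]; rewrite /= in_itv.
have mV : measurable (voronoi N t n).
  by apply: measurable_realfun.is_interval_measurable; exact: voronoi_is_interval.
have m1 : lebesgue_measure (`](t n - x)%R, (t n + x)%R[%classic : set R) = (2 * x)%:E.
  rewrite lebesgue_measure_itv /= lte_fin ifT -?EFinB; last by lra.
  by congr EFin; ring.
have m2 : lebesgue_measure (`](-1)%R, 1%R[%classic : set R) = 2%:E.
  rewrite lebesgue_measure_itv /= lte_fin ifT -?EFinB; last by lra.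
  by congr EFin; ring.
have le1 : (lebesgue_measure (`](t n - x)%R, (t n + x)%R[%classic : set R) <=
    lebesgue_measure (voronoi N t n))%E.
  by apply: le_measure => //; rewrite inE.
have le2 : (lebesgue_measure (voronoi N t n) <=
    lebesgue_measure (`](-1)%R, 1%R[%classic : set R))%E.
  by apply: le_measure => //; rewrite inE.
move: le1 le2; rewrite m1 m2 /tau.
(* The upper bound 2 excludes infinite measure, which [fine] would send to 0. *)
case: (lebesgue_measure (voronoi N t n)) => [v| |] //=.
by rewrite !lee_fin => ? _; lra.
Qed.

(** At the endpoint $s=-1$ every node is at least $2\xi$ away, since the gap from $t_0=-1$ enters
    $\xi$. *)
Lemma xi_le_hfill {R : realType} (N : nat) (t : nat -> R) :
  (0 < N)%N -> (forall n : nat, (1 <= n < N)%N -> t n < t n.+1) ->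
  -1 <= t 1%N -> t N <= 1 -> 0 < xi N t -> 2 * xi N t <= hfill N t.
Proof.
move=> N0 tinc t1 tN xi0.
have G := @sample_boundary_gap R N t _ N0 tinc t1 tN xi0.
pose D (s : R) := [set `|s - t n| | n in [set n : nat | (1 <= n <= N)%N]]%classic.
apply: (@le_trans _ _ (inf (D (-1)))).
  apply: lb_le_inf; first by exists `|-1 - t 1%N|; exists 1%N => //=; rewrite N0.
  move=> _ [n /= nN <-]; have [? ?] := G n nN.
  by rewrite ler_normr; lra.
apply: ub_le_sup; last by exists (-1) => //=; lra.
exists 2 => _ [s /= /andP[s1 s2] <-]; have [? ?] := G 1%N N0.
apply: (@le_trans _ _ `|s - t 1%N|); last by rewrite ler_norml; lra.
apply: ge_inf; last by exists 1%N => //=; rewrite N0.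
by exists 0 => _ [n _ <-].
Qed.

(** * Lower bound for [sigma_min] *)

Lemma Re_sum {R : realType} (s : seq nat) (F : nat -> R[i]) :
  complex.Re (\sum_(n <- s) F n) = \sum_(n <- s) complex.Re (F n).
Proof. by apply: (@big_morph R R[i] (@complex.Re R) 0 +%R 0 +%R) => // -[? ?] [? ?]. Qed.

Lemma Im_sum {R : realType} (s : seq nat) (F : nat -> R[i]) :
  complex.Im (\sum_(n <- s) F n) = \sum_(n <- s) complex.Im (F n).
Proof. by apply: (@big_morph R R[i] (@complex.Im R) 0 +%R 0 +%R) => // -[? ?] [? ?]. Qed.

Lemma adj_norm2E {R : realType} (N K : nat) (t : nat -> R) (y : nat -> R[i]) :
  adj_norm2 N t K y =
  \sum_(0 <= k < K.*2)
     expsum2 (index_iota 1 N.+1) (fun n => Num.sqrt (tau N t n) * complex.Re (y n))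
       (fun n => Num.sqrt (tau N t n) * complex.Im (y n))
       (fun n => pi * t n) (k%:R - K%:R).
Proof.
apply: eq_bigr => k _; rewrite /cmod2 /expsum2 Re_sum Im_sum.
have e n : (k%:Z - K%:Z)%:~R * pi * t n = (k%:R - K%:R) * (pi * t n) :> R.
  by rewrite intrB mulrA.
congr (_ ^+ 2 + _ ^+ 2); apply: eq_bigr => n _; rewrite /Umat /phi e;
  by case: (y n) => a b /=; ring.
Qed.

Lemma sigma_min_ge1 {R : realType} (N K : nat) (t : nat -> R) :
  (0 < N)%N -> (forall n : nat, (1 <= n < N)%N -> t n < t n.+1) ->
  -1 <= t 1%N -> t N <= 1 -> 0 < xi N t -> 3 <= K%:R * xi N t ->
  1 <= sigma_min N t K.
Proof.
move=> N0 tinc t1 tN xi0 K3.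
have K0 : (0 < K)%N by case: K K3 => //; rewrite mul0r; lra.
apply: lb_le_inf.
  (* The first unit vector shows that the infimum is over a nonempty set. *)
  exists (Num.sqrt (adj_norm2 N t K (fun n => (n == 1%N)%:R))).
  exists (fun n => (n == 1%N)%:R) => //=.
  rewrite big_ltn // big_nat big1 => [|n /andP[n2 _]].
    by rewrite /cmod2 /= addr0 expr0n expr1n addr0.
  by rewrite (gtn_eqF n2) /cmod2 /= expr0n addr0.
move=> _ [y /= y1 <-]; rewrite -sqrtr1; apply: ler_wsqrtr; rewrite adj_norm2E.
set a := fun n => _ * complex.Re _; set b := fun n => _ * complex.Im _.
have d0 : 0 < 2 * xi N t by rewrite mulr_gt0.
apply: le_trans (@separated_lower_bound R N K t a b _ d0 K0 _); last first.
  by move=> i j; exact: sample_separation.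
have W : xi N t <= \sum_(1 <= n < N.+1) (a n ^+ 2 + b n ^+ 2).
  rewrite -[leLHS]mulr1 -y1 big_distrr /= big_nat [leRHS]big_nat.
  apply: ler_sum => n nN.
  have tau_xi := @xi_le_tau R N t n N0 tinc t1 tN xi0 nN.
  rewrite /a /b !exprMn -mulrDr sqr_sqrtr; last lra.
  by apply: ler_wpM2r => //; rewrite addr_ge0 ?sqr_ge0.
have k0 : 0 < K%:R :> R by rewrite ltr0n.
set c := K%:R - _.
have cE : c * xi N t = K%:R * xi N t - 4 / (K%:R * xi N t).
  by rewrite /c; field; rewrite !gt_eqF.
(* The threshold 3 suffices because $3-4/3\ge1$. *)
have q : 4 / (K%:R * xi N t) <= 4 / 3.
  by rewrite ler_pM2l // lef_pV2 // posrE; lra.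
have c1 : 1 <= c * xi N t by rewrite cE; lra.
have c0 : 0 <= c by rewrite -(pmulr_lge0 _ xi0); lra.
by apply: le_trans c1 _; apply: ler_wpM2l.
Qed.

(** * From the hypotheses to $K\xi\ge3$ *)

Lemma decay_term_eq {R : realType} (r : nat) (k x : R) :
  0 < x -> 3 ^+ r * k ^- r * x `^ (- r%:R - 2^-1) = (3 / (k * x)) ^+ r / Num.sqrt x.
Proof.
move=> x0; rewrite powRB ?(gt_eqF x0) ?implybT // powR12_sqrt ?(ltW x0) //.
rewrite powRN powR_mulrn ?(ltW x0) // mulrA exprMn exprVn exprMn invfM.
by rewrite !mulrA.
Qed.

(** The first factor is at least $(3^r)^{1/r}=3$. From $x^2\le h$ follows $h^{1/(2r)}\ge x^{1/r}$,
    which cancels $x^{-1/r}$ and leaves $3/x$. *)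
Lemma bandwidth_ge {R : realType} (r : nat) (e h x : R) :
  (0 < r)%N -> 0 < e -> 0 < x -> x ^+ 2 <= h ->
  3 / x <= (Num.sqrt 2 * 3 ^+ r * (1 + e^-1)) `^ (r%:R^-1)
           * h `^ ((2 * r%:R)^-1) * x `^ (-1 - r%:R^-1).
Proof.
move=> r0 e0 x0 xh; have rn : r%:R != 0 :> R by rewrite pnatr_eq0 -lt0n.
have ri : 0 <= (r%:R : R)^-1 by rewrite invr_ge0.
have h0 : 0 <= h by apply: le_trans (sqr_ge0 x) xh.
have f1 : 3 <= (Num.sqrt 2 * 3 ^+ r * (1 + e^-1)) `^ (r%:R^-1).
  have {1}-> : 3 = (3 ^+ r) `^ (r%:R^-1) :> R.
    by rewrite -powR_mulrn // -powRrM divff // powRr1.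
  have s1 : 1 <= Num.sqrt 2 :> R by rewrite -{1}sqrtr1 ler_wsqrtr // ler1n.
  have p0 : 0 <= 3 ^+ r :> R by rewrite exprn_ge0.
  have i0 : 0 <= e^-1 by rewrite invr_ge0 ltW.
  apply: ge0_ler_powR => //; rewrite ?nnegrE //.
    by rewrite !mulr_ge0 // ?sqrtr_ge0; lra.
  rewrite mulrAC -[leLHS]mul1r ler_wpM2r // -[leLHS]mulr1; apply: ler_pM => //; lra.
rewrite -mulrA; apply: ler_pM => //; first by rewrite invr_ge0 ltW.
rewrite powRB ?(gt_eqF x0) ?implybT // powR_inv1 ?(ltW x0) // mulrCA -[leLHS]mulr1.
rewrite ler_pM2l ?invr_gt0 // ler_pdivlMr ?powR_gt0 // mul1r.
have -> : (r%:R : R)^-1 = 2%:R * (2 * r%:R)^-1 by field.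
rewrite powRrM powR_mulrn ?(ltW x0) //; apply: ge0_ler_powR;
  by rewrite ?nnegrE ?sqr_ge0 // invr_ge0.
Qed.

Theorem theorem6p4 (R : realType) (r : nat) (r_gt0 : (0 < r)%N) :
  exists C : R, 0 < C /\
  (forall (N : nat) (t : nat -> R) (K : nat),
     (0 < N)%N -> (0 < K)%N ->
     (forall n : nat, (1 <= n < N)%N -> t n < t n.+1) ->
     -1 <= t 1%N -> t N <= 1 ->
     0 < xi N t ->
     C * (K%:R ^- r) * xi N t `^ (- r%:R - 2^-1)
       < Num.sqrt (xi N t / (2 * hfill N t)) ->
     1 - (C * (K%:R ^- r) * xi N t `^ (- r%:R - 2^-1))
         / (Num.sqrt (xi N t / (2 * hfill N t))
            - C * (K%:R ^- r) * xi N t `^ (- r%:R - 2^-1))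
       <= sigma_min N t K) /\
  (forall (N : nat) (t : nat -> R) (K : nat) (eps : R),
     (0 < N)%N -> (0 < K)%N ->
     (forall n : nat, (1 <= n < N)%N -> t n < t n.+1) ->
     -1 <= t 1%N -> t N <= 1 ->
     0 < xi N t ->
     0 < eps < 1 ->
     (Num.sqrt 2 * C * (1 + eps^-1)) `^ (r%:R^-1)
       * hfill N t `^ ((2 * r%:R)^-1) * xi N t `^ (-1 - r%:R^-1) <= K%:R ->
     1 - eps < sigma_min N t K).
Proof.
exists (3 ^+ r); split; first by rewrite exprn_gt0.
split=> [N t K N0 K0 tinc t1 tN xi0|N t K eps N0 K0 tinc t1 tN xi0 /andP[e0 e1]].
  have x1 := @xi_le_half R N t N0 tinc t1 tN xi0.
  have xh := @xi_le_hfill R N t N0 tinc t1 tN xi0.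
  rewrite decay_term_eq //; set d := _ / Num.sqrt _ => dlt.
  have kx0 : 0 < K%:R * xi N t by rewrite mulr_gt0 // ltr0n.
  have q0 : 0 < 3 / (K%:R * xi N t) by rewrite divr_gt0.
  have d0 : 0 <= d by rewrite divr_ge0 ?sqrtr_ge0 // exprn_ge0 // ltW.
  have K3 : 3 <= K%:R * xi N t.
    (* If $K\xi<3$, then $(3/(K\xi))^r\ge1$ and $\sqrt\xi\le1$ give $d\ge1$, whereas $2\xi\le h$
       gives $\sqrt{\xi/(2h)}\le1$, against [dlt]. *)
    rewrite leNgt; apply: contraL dlt => K3; rewrite -leNgt.
    apply: (@le_trans _ _ 1).
      rewrite -[leRHS]sqrtr1 ler_wsqrtr // ler_pdivrMr; lra.
    rewrite ler_pdivlMr ?sqrtr_gt0 // mul1r; apply: (@le_trans _ _ 1).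
      by rewrite -[leRHS]sqrtr1 ler_wsqrtr //; lra.
    by rewrite exprn_ege1 // ler_pdivlMr //; lra.
  apply: le_trans _ (@sigma_min_ge1 R N K t N0 tinc t1 tN xi0 K3).
  (* The subtracted quotient is nonnegative, so the claimed bound is at most 1. *)
  by rewrite lerBlDr lerDl divr_ge0 // subr_ge0 ltW.
have x1 := @xi_le_half R N t N0 tinc t1 tN xi0.
have xh := @xi_le_hfill R N t N0 tinc t1 tN xi0.
(* $\xi^2\le\xi/2\le h$, from $\xi\le1/2$ and $2\xi\le h$. *)
have xh2 : xi N t ^+ 2 <= hfill N t by nra.
move=> /(le_trans (@bandwidth_ge R r eps _ _ r_gt0 e0 xi0 xh2)); rewrite ler_pdivrMr // => K3.
by have := @sigma_min_ge1 R N K t N0 tinc t1 tN xi0 K3; lra.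
Qed.
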